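(* For $n\ge 4$, the collapsibility number of the Čech complex $\mathcal{N}(\mathbb{I}_n,3)$ is $5$.
   Context: For a finite simple connected graph $G$ and a real number $r\ge 0$, the Čech complex $\mathcal{N}(G,r)$ is the simplicial complex with vertex set $V(G)$ in which a finite nonempty set $\sigma\subseteq V(G)$ is a simplex if and only if the closed balls of radius $\frac r2$ centered at the vertices of $\sigma$ have a common point, the balls being taken in the geometric realization of $G$ with the shortest path metric in which each edge is isometric to $[0,1]$. The hypercube graph $\mathbb{I}_n$ has vertex set $\{0,1\}^n$, two vertices adjacent iff they differ in exactly one coordinate. Let $X$ be a finite simplicial complex. If $\sigma\in X$ satisfies $|\sigma|\le d$ and there is a unique maximal simplex $\gamma\in X$ containing $\sigma$, then removing from $X$ all simplices $\delta$ with $\sigma\subseteq\delta\subseteq\gamma$ yields a subcomplex $Y$, called an elementary $d$-collapse of $X$ (here $\gamma=\sigma$ is allowed). $X$ is $d$-collapsible if there is a finite sequence of elementary $d$-collapses from $X$ to the void (empty) complex. The collapsibility number of $X$ is the minimal integer $d$ such that $X$ is $d$-collapsible. *)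

(* Defs.v *)
From HB Require Import structures.
From mathcomp Require Import boolp classical_sets reals.
(* finset is imported after classical_sets so that [set0], [setD], ... and the
   bracket notations denote finite sets. *)
From mathcomp Require Import all_boot all_order all_algebra.
Import Order.TTheory GRing.Theory Num.Theory.

Set Implicit Arguments.
Unset Strict Implicit.
Unset Printing Implicit Defensive.

Local Open Scope ring_scope.

Record connected_graph := ConnectedGraph {
  vertex :> finType;
  adj : rel vertex;
  adj_sym : symmetric adj;
  adj_irr : irreflexive adj;
  adj_connected : forall x y, connect adj x y
}.

Section Realization.
Variables (R : realType) (G : connected_graph).

(* Points of the geometric realization, in barycentric coordinates. *)
Definition vertex_point (v : G) : {ffun G -> R} := [ffun z => (z == v)%:R].

Definition closed_edge (x y : G) (p : {ffun G -> R}) : Prop :=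
  [/\ 0 <= p x, 0 <= p y, p x + p y = 1
    & forall z, z != x -> z != y -> p z = 0].

Definition realization (p : {ffun G -> R}) : Prop :=
  (exists v : G, p = vertex_point v) \/
  (exists x y : G, adj x y /\ closed_edge x y p).

(* [path_length p q l]: some piecewise linear path from p to q, each piece of
   which stays in one closed edge, has length l. As |p x - q x| = |p y - q y|
   for p, q on the edge xy, each edge is a copy of [0, 1]. *)
Inductive path_length : {ffun G -> R} -> {ffun G -> R} -> R -> Prop :=
| path_length_refl p : realization p -> path_length p p 0
| path_length_step p q s (x y : G) l :
    adj x y -> closed_edge x y p -> closed_edge x y q ->
    path_length q s l -> path_length p s (`|p x - q x| + l).

Definition path_dist (p q : {ffun G -> R}) : R := inf (path_length p q).

Definition closed_ball (p : {ffun G -> R}) (r : R) (q : {ffun G -> R}) : Prop :=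
  realization q /\ path_dist p q <= r.

Definition cech (r : R) : {set {set G}} :=
  [set s : {set G} | (s != set0) &&
    `[< exists p, forall v, v \in s -> closed_ball (vertex_point v) (r / 2) p >]].

End Realization.

(* A finite simplicial complex is the set of its nonempty simplices, so the
   void complex is set0. *)
Definition simplicial_complex (T : finType) (X : {set {set T}}) : Prop :=
  set0 \notin X /\
  forall s t : {set T}, s \in X -> t \subset s -> t != set0 -> t \in X.

Lemma cech_simplicial_complex (R : realType) (G : connected_graph) (r : R) :
  simplicial_complex (cech G r).
Proof.
split=> [|s t]; first by rewrite inE eqxx.
rewrite !inE => /andP[_ /asboolP[p hp]] ts ->.
by apply/asboolP; exists p => v vt; apply: hp; apply: (subsetP ts).
Qed.

Section Collapse.
Variable T : finType.
Implicit Types X Y : {set {set T}}.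

Definition elementary_collapse (d : nat) X Y : Prop :=
  exists s g : {set T},
    [/\ (s \in X) && (#|s| <= d)%N,
        maxset (mem X) g && (s \subset g),
        forall g' : {set T}, maxset (mem X) g' -> s \subset g' -> g' = g
      & Y = X :\: [set t : {set T} | (s \subset t) && (t \subset g)]].

Inductive collapsible (d : nat) : {set {set T}} -> Prop :=
| collapsible_void : collapsible d set0
| collapsible_step X Y :
    elementary_collapse d X Y -> collapsible d Y -> collapsible d X.

Definition is_collapsibility_number X (d : nat) : Prop :=
  collapsible d X /\ forall d' : nat, collapsible d' X -> (d <= d')%N.

Lemma elementary_collapse_complex d X Y :
  simplicial_complex X -> elementary_collapse d X Y -> simplicial_complex Y.
Proof.
move=> [X0 Xdown] [s [g [_ _ guniq ->]]]; split=> [|u t].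
  by rewrite inE (negPf X0) andbF.
rewrite !inE => /andP[nu uX] tu t0; rewrite (Xdown u t) // andbT.
apply: contra nu => /andP[st _]; rewrite (subset_trans st tu) /=.
have [g' mg' ug'] := @maxset_exists T (mem X) u uX.
by rewrite -(guniq g' mg') // (subset_trans st) // (subset_trans tu).
Qed.

End Collapse.

Section Hypercube.
Variable n : nat.
Implicit Types u v : {ffun 'I_n -> bool}.

Definition cube_adj : rel {ffun 'I_n -> bool} :=
  fun u v => #|[set i | u i != v i]| == 1%N.

Lemma cube_adj_sym : symmetric cube_adj.
Proof.
move=> u v; rewrite /cube_adj; congr (#|pred_of_set _| == _).
by apply/setP=> i; rewrite !inE eq_sym.
Qed.

Lemma cube_adj_irr : irreflexive cube_adj.
Proof.
move=> u; rewrite /cube_adj (_ : [set _ | _] = set0) ?cards0 //.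
by apply/setP=> i; rewrite !inE eqxx.
Qed.

Lemma cube_adj_connected u v : connect cube_adj u v.
Proof.
have [k] := ubnP #|[set i | u i != v i]|; elim: k u => // k IH u.
rewrite ltnS => huv; have [e0|[i]] := set_0Vmem [set i | u i != v i].
  suff -> : u = v by exact: connect0.
  apply/ffunP=> i; apply/eqP; move/setP: e0 => /(_ i).
  by rewrite !inE => /negbFE.
rewrite inE => ui; pose w := [ffun j => if j == i then v i else u j].
apply: (@connect_trans _ _ w).
  apply: connect1; rewrite /cube_adj (_ : [set _ | _] = [set i]) ?cards1 //.
  apply/setP=> j; rewrite !inE ffunE; have [->|_] := eqVneq j i; first by rewrite ui.
  by rewrite eqxx.
apply: IH; apply: leq_trans huv; apply: proper_card; apply/properP; split.
  by apply/subsetP=> j; rewrite !inE ffunE; have [->|] := eqVneq j i; rewrite ?eqxx.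
by exists i; rewrite !inE ?ffunE ?eqxx.
Qed.

Definition hypercube : connected_graph :=
  ConnectedGraph cube_adj_sym cube_adj_irr cube_adj_connected.

End Hypercube.

(* Main.v *)
Require Import Defs.
From mathcomp Require Import boolp classical_sets reals.
From mathcomp Require Import all_boot all_order all_algebra lra ring.
Import Order.TTheory GRing.Theory Num.Theory.

Set Implicit Arguments.
Unset Strict Implicit.
Unset Printing Implicit Defensive.

(** The balls of radius 3/2 around the vertices of [s] meet iff [s] is contained
in N(x) ∪ N(y) for some edge xy: test at the midpoint of xy in one direction,
and use that the Hamming distance to [v] extends affinely to a 1-Lipschitz
function in the other.

Upper bound. Add the simplices F = N(x) ∪ N(y) one at a time, in any order.
Distinct vertices have at most two common neighbours, so another facet either
meets F in at most 4 vertices or, if its edge shares the endpoint x, say,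
contains F minus N(y) \ x and meets N(y) \ x at most once. Hence a new simplex
of F is already recognised as new from its first two vertices in N(x) \ y, its
first two in N(y) \ x and one more vertex; collapsing along this choice removes
the new simplices by elementary 5-collapses.

Lower bound. The six vertices of a 3-dimensional face other than two antipodal
ones form a missing face, i.e. a nonsimplex with all proper subsets simplices. *)

(** * Collapsing along binary decision trees *)

Section Collapsing.
Variables (T : finType) (d : nat).
Implicit Types (X K : {set {set T}}) (M G F H A B S t u : {set T}) (s : seq {set T}).

Definition down_closed K := forall t u, t \in K -> u \subset t -> u \in K.

(* [branching K M G]: the sets t outside K with M ⊆ t ⊆ G can be split, by a
   binary decision tree on membership of vertices, into intervals [M', G'] with
   M' outside K and #|M'| <= d. *)
Inductive branching K M G : Prop :=
| branching_done of G \in K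
| branching_free of M \notin K & #|M| <= d
| branching_split c of c \in G & c \notin M
    & branching K (c |: M) G & branching K M (G :\ c).

(** A free leaf is one elementary collapse: all supersets of [M] are outside [K], so every simplex
    containing [M] lies in [G], the unique maximal one. At a split on [c], the simplices through [c]
    go first, then those avoiding it. The empty set is adjoined to [X] because [G] may shrink to
    it. *)
Lemma branching_collapse K M G :
    set0 \in K -> down_closed K -> branching K M G ->
  forall X, simplicial_complex X -> K \subset set0 |: X -> M \subset G ->
    G \in set0 |: X ->
    (forall t, t \in X -> M \subset t -> t \notin K -> t \subset G) ->
  collapsible d (X :\: [set t : {set T} | (M \subset t) && (t \notin K)]) ->
  collapsible d X.
Proof.
move=> K0 Kdown; elim=> {M G} [M G GK|M G MK leMd|M G c cG cM _ IHin _ IHout]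
  X [X0 Xdown] KX MG GX XG.
- rewrite (_ : _ :\: _ = X) //; apply/setP=> t; rewrite !inE.
  have [tX|] := boolP (t \in X); rewrite ?andbF // andbT.
  apply/negP=> /andP[Mt tK]; case/negP: (tK).
  exact: Kdown GK (XG t tX Mt tK).
- have upK t : M \subset t -> t \notin K.
    by move=> Mt; apply: contra MK => /Kdown; apply.
  have M0 : M != set0 by apply: contraNneq MK => ->.
  have GX' : G \in X.
    by case/setU1P: GX => // G0; rewrite G0 subset0 (negPf M0) in MG.
  apply: collapsible_step; exists M, G; split.
  + by rewrite leMd (Xdown _ _ GX').
  + rewrite MG andbT; apply/maxsetP; split=> // H HX GH.
    by apply/eqP; rewrite eqEsubset GH XG ?upK // (subset_trans MG).
  + by move=> H /maxsetP[HX Hmax] MH; rewrite (Hmax G) // XG // upK.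
  + apply/setP=> t; rewrite !inE; have [Mt|] //= := boolP (M \subset t).
    rewrite upK //; have [tX|] := boolP (t \in X); rewrite ?andbF //.
    by rewrite XG ?upK.
- move=> coll; apply: (IHin X) => //.
  + by rewrite subUset sub1set cG.
  + by move=> t tX; rewrite subUset => /andP[_ Mt]; apply: XG.
  (* [X1] is what the branch through [c] leaves; it is a complex because [K] is closed under
     subsets. *)
  set X1 := _ :\: _.
  have inX1 t : (t \in X1) = (t \in X) && ((c |: M \subset t) ==> (t \in K)).
    by rewrite !inE negb_and negbK implybE andbC.
  apply: (IHout X1).
  + split=> [|t u]; rewrite ?inX1 ?(negPf X0) // => /andP[tX tK] ut u0.
    rewrite (Xdown t) //=; apply/implyP=> cu.
    by apply: (Kdown t) => //; apply: (implyP tK); apply: subset_trans ut.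
  + apply/subsetP=> t tK; have := subsetP KX t tK; rewrite !in_setU1 inX1 tK implybT.
    by rewrite andbT.
  + by rewrite subsetD1 MG.
  + rewrite in_setU1 inX1 subUset sub1set !inE eqxx /= andbT.
    have [//|G0 /=] := eqVneq (G :\ c) set0; apply: (Xdown G) => //.
      by case/setU1P: GX => // G_0; rewrite G_0 inE in cG.
    exact: subD1set.
  + move=> t; rewrite inX1 => /andP[tX tK] Mt tnK.
    rewrite subsetD1 XG //=; apply: contra tnK => ct.
    by apply: (implyP tK); rewrite subUset sub1set ct.
  rewrite (_ : X1 :\: _ = X :\: [set t : {set T} | (M \subset t) && (t \notin K)]) //.
  apply/setP=> t; rewrite in_setD inX1 in_setD; case: (t \in X); rewrite ?andbF //=.
  rewrite subUset inE; case: (M \subset t); rewrite /= ?andbF ?andbT //.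
  by case: (t \in K); rewrite //= ?implybT.
Qed.

(** The tree queries undecided vertices of [S] until [r] of them are accepted or none is left; only
    these leaves remain to be branched. *)
Lemma branching_pick r S K M G :
    M \subset G -> #|M :&: S| <= r ->
    (forall M' G', M \subset M' -> M' \subset G' -> G' \subset G ->
       M' :\: S = M :\: S -> #|M' :&: S| <= r ->
       (#|M' :&: S| == r) || (G' :&: S \subset M') -> branching K M' G') ->
  branching K M G.
Proof.
have [k] := ubnP #|G :\: M|; elim: k M G => // k IH M G; rewrite ltnS => lek MG Mr brK.
have [sat|] := boolP ((#|M :&: S| == r) || (G :&: S \subset M)); first exact: brK.
rewrite negb_or => /andP[neMr /subsetPn[c /setIP[cG cS] cM]].
have cGM : c \in G :\: M by rewrite inE cM.
have ltMr : #|M :&: S| < r by rewrite ltn_neqAle neMr.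
apply: (branching_split cG cM); apply: IH.
- apply: leq_trans lek; apply: proper_card; apply/properP; split.
    by apply: setDS; apply: subsetUr.
  by exists c => //; rewrite !inE eqxx.
- by rewrite subUset sub1set cG.
- by rewrite setIUl (setIidPl _) ?sub1set // cardsU1 inE (negPf cM) add1n.
- move=> M' G' cM' MG' GG' eM'; apply: brK => //.
    by apply: subset_trans cM'; apply: subsetUr.
  rewrite eM' setDUl (_ : [set c] :\: S = set0) ?set0U //.
  by apply/eqP; rewrite setD_eq0 sub1set.
- apply: leq_trans lek; apply: proper_card; apply/properP; split.
    by apply: setSD; apply: subD1set.
  by exists c => //; rewrite !inE eqxx andbF.
- by rewrite subsetD1 MG.
- by [].
- move=> M' G' MM' MG' GG'; apply: brK => //.
  by apply: (subset_trans GG'); apply: subD1set.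
Qed.

(** Splitting on arbitrary vertices stops once [G] enters [K] or [M] leaves it; the hypothesis
    forces a stop by the time [M] has [d] vertices. *)
Lemma branching_fill K M G :
    M \subset G -> #|M| <= d ->
    (forall M' G', M \subset M' -> M' \subset G' -> G' \subset G ->
       G' \notin K -> #|M'| = d -> M' \notin K) ->
  branching K M G.
Proof.
have [k] := ubnP #|G :\: M|; elim: k M G => // k IH M G; rewrite ltnS => lek MG Md freeK.
have [GK|GK] := boolP (G \in K); first exact: branching_done.
have [MK|MK] := boolP (M \in K); last exact: branching_free.
have ltMd : #|M| < d.
  by rewrite ltn_neqAle Md andbT; apply: contraL MK => /eqP; apply: freeK GK.
have /subsetPn[c cG cM] : ~~ (G \subset M).
  by apply: contra GK => GM; rewrite (_ : G = M) //; apply/eqP; rewrite eqEsubset GM.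
have cGM : c \in G :\: M by rewrite inE cM.
apply: (branching_split cG cM); apply: IH.
- apply: leq_trans lek; apply: proper_card; apply/properP; split.
    by apply: setDS; apply: subsetUr.
  by exists c => //; rewrite !inE eqxx.
- by rewrite subUset sub1set cG.
- by rewrite cardsU1 cM.
- move=> M' G' cM'; apply: freeK.
  by apply: subset_trans cM'; apply: subsetUr.
- apply: leq_trans lek; apply: proper_card; apply/properP; split.
    by apply: setSD; apply: subD1set.
  by exists c => //; rewrite !inE eqxx andbF.
- by rewrite subsetD1 MG.
- by [].
- move=> M' G' MM' MG' GG'; apply: freeK => //.
  by apply: (subset_trans GG'); apply: subD1set.
Qed.

(** Query [A] for two vertices, then [B] for two, then fill up to [d]; [4 <= d] leaves room for the
    first four. If a filled [M] is in [K], the side [S] it meets at most once was queried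
    exhaustively, so [M] contains all of [G] in [S]. *)
Lemma branching_two_sides K F A B :
    4 <= d -> down_closed K -> [disjoint A & B] ->
    (forall t, t \in K -> t \subset F ->
       #|t| < d \/ exists2 S, S = A \/ S = B &
         #|t :&: S| <= 1 /\ (t :&: S) :|: (F :\: S) \in K) ->
  branching K set0 F.
Proof.
move=> d4 Kdown dAB Kt; apply: (@branching_pick 2 A); rewrite ?sub0set ?set0I ?cards0 //.
move=> M1 G1 _ MG1 G1F; rewrite set0D => /eqP; rewrite setD_eq0 => M1A.
rewrite (setIidPl M1A) => cM1 sat1.
have M1B : M1 :&: B = set0.
  by apply: disjoint_setI0; apply: disjointWl dAB.
apply: (@branching_pick 2 B) => //; first by rewrite M1B cards0.
move=> M2 G2 M12 MG2 G21 M2D cM2 sat2.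
apply: branching_fill => // [|M G M2M MG GG2 GK Md].
  apply: leq_trans d4; rewrite -(cardsID B) M2D -[4]/(2 + 2) leq_add //.
  by apply: leq_trans cM1; apply: subset_leq_card; apply: subsetDl.
have GF : G \subset F by apply: subset_trans GG2 (subset_trans G21 G1F).
apply: contra GK => MK; have [|[S AB [MS SK]]] := Kt M MK (subset_trans MG GF).
  by rewrite Md ltnn.
(* Then [G] lies in the union of [M :&: S] and [F :\: S], a member of [K]. *)
suff GS : G :&: S \subset M.
  apply: Kdown SK _; apply/subsetP=> v vG; rewrite !inE (subsetP GF v vG) andbT.
  case: (boolP (v \in S)) => vS; rewrite ?orbT // andbT orbF.
  by apply: (subsetP GS); rewrite inE vG.
case: AB MS {SK} => -> MS.
- case/orP: sat1 => [/eqP M12' | G1A].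
    suff: 2 <= #|M :&: A| by rewrite leqNgt ltnS MS.
    rewrite -M12'; apply: subset_leq_card; rewrite subsetI M1A andbT.
    exact: subset_trans M12 M2M.
  apply: subset_trans (subset_trans M12 M2M); apply: subset_trans G1A.
  by apply: setSI; apply: subset_trans GG2 G21.
- case/orP: sat2 => [/eqP M2B | G2B].
    suff: 2 <= #|M :&: B| by rewrite leqNgt ltnS MS.
    by rewrite -M2B; apply: subset_leq_card; apply: setSI.
  by apply: subset_trans M2M; apply: subset_trans G2B; apply: setSI.
Qed.

(** * Complexes generated by a list of facets *)

Lemma down_closed_complex X : simplicial_complex X -> down_closed (set0 |: X).
Proof.
move=> [_ Xdown] t u; rewrite !in_setU1 => /orP[/eqP-> | tX] ut.
  by rewrite -subset0 ut.
by have [//|u0] := eqVneq u set0; rewrite (Xdown t).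
Qed.

Definition generated_complex s : {set {set T}} :=
  [set t : {set T} | (t != set0) && has (fun F : {set T} => t \subset F) s].

Lemma generated_complexP s : simplicial_complex (generated_complex s).
Proof.
split=> [|t u]; first by rewrite inE eqxx.
rewrite !inE => /andP[_ /hasP[F Fs tF]] ut -> /=.
by apply/hasP; exists F => //; apply: subset_trans tF.
Qed.

Lemma collapsible_generated_cons s F :
    branching (set0 |: generated_complex s) set0 F ->
  collapsible d (generated_complex s) -> collapsible d (generated_complex (F :: s)).
Proof.
move=> br coll; apply: (branching_collapse _ _ br).
- exact: setU11.
- by apply: down_closed_complex; apply: generated_complexP.
- exact: generated_complexP.
- apply: setUS; apply/subsetP=> t; rewrite !inE /= => /andP[-> ->]; exact: orbT.
- exact: sub0set.
- by rewrite !inE /= subxx andbT orbN.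
- move=> t; rewrite !inE /= => /andP[t0 /orP[//|ts]] _.
  by rewrite (negPf t0) ts.
rewrite (_ : _ :\: _ = generated_complex s) //; apply/setP=> t; rewrite !inE sub0set /=.
by case: eqP => //= _; case: (has _ s); rewrite ?orbT ?andbF.
Qed.

(** The condition on pairs passes to sublists, so induction works for any order of the facets. For a
    common simplex of [F] and an older facet [H], the alternative for [H] yields the one in
    [branching_two_sides]. *)
Lemma collapsible_generated s :
    4 <= d ->
    (forall F, F \in s -> exists A B, [disjoint A & B] /\
       forall H, H \in s -> H != F -> #|H :&: F| < d \/
         exists2 S, S = A \/ S = B & #|H :&: S| <= 1 /\ F :\: S \subset H) ->
  collapsible d (generated_complex s).
Proof.
move=> d4; elim: s => [_|F s IH hs].
  rewrite (_ : generated_complex _ = set0); first exact: collapsible_void.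
  by apply/setP=> t; rewrite !inE andbF.
apply: collapsible_generated_cons; last first.
  apply: IH => G Gs; have [|A [B [dAB AB]]] := hs G; first by rewrite inE Gs orbT.
  by exists A, B; split=> // H Hs; apply: AB; rewrite inE Hs orbT.
(* If [F] is already in [K], nothing is to be removed; otherwise [F] differs from every older
   facet. *)
set K := set0 |: _; have [FK|FK] := boolP (F \in K); first exact: branching_done.
have [|A [B [dAB AB]]] := hs F; first by rewrite inE eqxx.
have Kdown : down_closed K by apply: down_closed_complex; apply: generated_complexP.
have inK t H : H \in s -> t \subset H -> t \in K.
  move=> Hs tH; rewrite !inE orbC; case: eqP; rewrite ?orbT //= orbF => _.
  by apply/hasP; exists H.
apply: (branching_two_sides d4 Kdown dAB) => t.
rewrite in_setU1 => /orP[/eqP-> _ | ]; first by left; rewrite cards0 (leq_trans _ d4).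
rewrite inE => /andP[_ /hasP[H Hs tH]] tF.
have HF : H != F by apply: contraNneq FK => <-; apply: inK Hs _.
have [||le|[S SAB [HS FH]]] := AB H; rewrite ?inE ?Hs ?orbT //.
  by left; apply: leq_ltn_trans le; apply: subset_leq_card; rewrite subsetI tH.
right; exists S => //; split.
  by apply: leq_trans HS; apply: subset_leq_card; apply: setSI.
by apply: (inK _ H) => //; rewrite subUset FH andbT; apply: subset_trans tH; apply: subsetIl.
Qed.

(* A collapse removing a facet of the missing face S starts at a simplex with
   at most d vertices; if #|S| > d + 1 it lies in two facets of S, whose union is S. *)
Lemma missing_face_collapsible X S :
    simplicial_complex X -> S != set0 -> S \notin X ->
    (forall v, v \in S -> S :\ v \in X) ->
  collapsible d X -> #|S| <= d.+1.
Proof.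
move=> cX S0 SX SvX coll; move: cX SX SvX.
elim: coll => {X} [_ _ SvX|X Y XY _ IH cX SX SvX].
  by have /set0Pn[v /SvX] := S0; rewrite inE.
rewrite leqNgt; apply/negP=> ltdS.
have [/forall_inP SvY|] := boolP [forall v in S, S :\ v \in Y].
  move: ltdS; rewrite ltnNge IH //; first exact: elementary_collapse_complex XY.
  by apply: contra SX; case: XY => [? [? [_ _ _ ->]]] /setDP[].
case: XY => m [g [/andP[mX md] /andP[gmax mg] guniq ->]].
rewrite negb_forall_in => /exists_inP[v vS].
rewrite !inE SvX // andbT negbK => /andP[mSv Svg].
have /subsetPn[w wSv wm] : ~~ (S :\ v \subset m).
  apply/negP=> /subset_leq_card; rewrite leqNgt (leq_ltn_trans md) //.
  by move: ltdS; rewrite (cardsD1 v S) vS add1n ltnS.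
have [wv wS] := setD1P wSv.
have [h hmax Swh] := @maxset_exists _ (mem X) _ (SvX w wS).
have mSw : m \subset S :\ w by rewrite subsetD1 wm (subset_trans mSv) ?subD1set.
have hg : h = g by apply: guniq => //; apply: subset_trans Swh.
case/negP: SX; case/maxsetP: gmax => gX _; apply: cX.2 gX _ S0.
apply/subsetP=> u uS; have [->|uv] := eqVneq u v.
  by rewrite -hg; apply: (subsetP Swh); rewrite !inE eq_sym wv.
by apply: (subsetP Svg); rewrite !inE uv.
Qed.

End Collapsing.

(** * Hamming distance and common neighbours in the cube *)

Section CubeNeighbourhoods.
Variable n : nat.
Local Notation V := {ffun 'I_n -> bool}.
Implicit Types u v w x y : V.

(** As a sum, it makes the triangle inequality and the parity formula termwise, and lets three
    coordinates be split off. *)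
Definition hamming u v : nat := \sum_i (u i != v i).

Lemma cube_adjE u v : cube_adj u v = (hamming u v == 1).
Proof.
rewrite /cube_adj /hamming -sum1_card big_mkcond /=; congr (_ == _).
by apply: eq_bigr => i _; rewrite inE; case: (_ != _).
Qed.

Lemma hammingC u v : hamming u v = hamming v u.
Proof. by apply: eq_bigr => i _; rewrite eq_sym. Qed.

Lemma hamming_triangle u v w : hamming u w <= hamming u v + hamming v w.
Proof.
rewrite /hamming -big_split; apply: leq_sum => i _ /=.
by case: (u i) (v i) (w i) => [] [] [].
Qed.

(** The bipartition of the cube, which keeps the neighbourhoods of two adjacent vertices apart. *)
Definition parity u : bool := \big[addb/false]_i u i.

Lemma odd_hamming u v : odd (hamming u v) = parity u (+) parity v.
Proof.
rewrite /hamming (big_morph odd oddD (erefl _)) /parity -big_split /=.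
by apply: eq_bigr => i _; case: (u i) (v i) => [] [].
Qed.

Lemma cube_adj_parity u v : cube_adj u v -> parity v = ~~ parity u.
Proof.
rewrite cube_adjE => /eqP uv; have := odd_hamming u v.
by rewrite uv; case: (parity u) (parity v) => [] [].
Qed.

(** The triangle inequality bounds the difference by 1, and parity excludes equality. *)
Lemma hamming_adj u x y :
  cube_adj x y -> hamming u y = (hamming u x).+1 \/ hamming u x = (hamming u y).+1.
Proof.
move=> xy; have pxy := cube_adj_parity xy; move: xy; rewrite cube_adjE => /eqP xy.
have := hamming_triangle u x y; have := hamming_triangle u y x.
have : odd (hamming u x) != odd (hamming u y).
  by rewrite !odd_hamming pxy; case: (parity u) (parity x) => [] [].
rewrite (hammingC y x) xy !addn1.
case: (ltngtP (hamming u x) (hamming u y)) => [lt _ _ le|lt _ le _|->].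
- by left; apply/eqP; rewrite eqn_leq le.
- by right; apply/eqP; rewrite eqn_leq le.
- by rewrite eqxx.
Qed.

Definition nbh x : {set V} := [set y | cube_adj x y].

(** One common neighbour shows that [u] and [v] differ in at most two coordinates; every common
    neighbour is [u] flipped at one of these. *)
Lemma card_common_nbh u v : u != v -> #|nbh u :&: nbh v| <= 2.
Proof.
move=> neq_uv; have [->|[w0]] := set_0Vmem (nbh u :&: nbh v); first by rewrite cards0.
rewrite !inE => /andP[uw0 vw0].
pose flip i : V := [ffun j => u j (+) (j == i)].
pose D := [set i | u i != v i].
have leD : #|D| <= 2.
  have -> : #|D| = hamming u v.
    rewrite /hamming -sum1_card big_mkcond /=.
    by apply: eq_bigr => i _; rewrite inE; case: (_ != _).
  move: uw0 vw0; rewrite !cube_adjE (hammingC v) => /eqP uw0 /eqP vw0.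
  by apply: leq_trans (hamming_triangle u w0 v) _; rewrite uw0 vw0.
apply: leq_trans leD; apply: leq_trans (leq_imset_card flip _).
apply: subset_leq_card; apply/subsetP=> w; rewrite !inE => /andP[/cards1P[i ui] /cards1P[j vj]].
have uwE k : (u k != w k) = (k == i) by move/setP/(_ k): ui; rewrite !inE.
have vwE k : (v k != w k) = (k == j) by move/setP/(_ k): vj; rewrite !inE.
apply/imsetP; exists i; last first.
  by apply/ffunP=> k; rewrite ffunE -uwE; case: (u k) (w k) => [] [].
(* If [u] and [v] agreed at [i], then [v] would also differ from [w] exactly at [i], so [u = v]. *)
rewrite inE; apply: contra neq_uv => /eqP uvi; apply/eqP/ffunP=> k.
have ij : i = j by apply/eqP; rewrite -vwE -uvi uwE.
move: (uwE k) (vwE k); rewrite ij => <-.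
by case: (u k) (v k) (w k) => [] [] [].
Qed.

(** * Facets from edges, and the upper bound *)

Definition cube_facet (e : V * V) : {set V} := nbh e.1 :|: nbh e.2.

(** Each edge is listed once, from its even end [x], so the odd vertices of a facet are those of
    N(x) and the even ones those of N(y). *)
Definition cube_edges : seq (V * V) :=
  [seq e <- enum {: V * V} | ~~ parity e.1 && cube_adj e.1 e.2].

Definition cube_complex := generated_complex (map cube_facet cube_edges).

Lemma mem_cube_edges x y : ((x, y) \in cube_edges) = ~~ parity x && cube_adj x y.
Proof. by rewrite mem_filter mem_enum andbT. Qed.

Lemma mem_facet_odd x y v : (x, y) \in cube_edges -> parity v ->
  (v \in cube_facet (x, y)) = (v \in nbh x).
Proof.
rewrite mem_cube_edges => /andP[px xy] pv; rewrite !inE /=; case: (cube_adj x v) => //=.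
apply/negP=> /cube_adj_parity; rewrite pv (cube_adj_parity xy).
by rewrite (negPf px).
Qed.

Lemma mem_facet_even x y v : (x, y) \in cube_edges -> ~~ parity v ->
  (v \in cube_facet (x, y)) = (v \in nbh y).
Proof.
rewrite mem_cube_edges => /andP[px xy] pv; rewrite !inE /= orbC.
case: (cube_adj y v) => //=; apply/negP=> /cube_adj_parity.
by rewrite (negPf px) (negPf pv).
Qed.

(** The mixed intersections vanish by parity. *)
Lemma cube_facetI x y u v : (x, y) \in cube_edges -> (u, v) \in cube_edges ->
  cube_facet (u, v) :&: cube_facet (x, y) = (nbh u :&: nbh x) :|: (nbh v :&: nbh y).
Proof.
move=> exy euv; apply/setP=> w; rewrite in_setI in_setU !in_setI.
have := exy; have := euv; rewrite !mem_cube_edges => /andP[pu uv] /andP[px xy].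
have [pw|pw] := boolP (parity w).
  rewrite !mem_facet_odd // [w \in nbh v]inE; case: (boolP (cube_adj v w)) => [/cube_adj_parity|].
    by rewrite pw (cube_adj_parity uv) (negPf pu).
  by rewrite orbF.
rewrite !mem_facet_even // [w \in nbh u]inE; case: (boolP (cube_adj u w)) => [/cube_adj_parity|//].
by rewrite (negPf pw) (negPf pu).
Qed.

(** The endpoints are taken out of the two sides because a facet sharing the endpoint [x] always
    contains [x], which uses up one of the two common neighbours allowed on the side of [y]. *)
Lemma collapsible_cube_complex : collapsible 5 cube_complex.
Proof.
apply: collapsible_generated => // _ /mapP[[x y] exy ->].
exists (nbh x :\ y), (nbh y :\ x).
have := exy; rewrite mem_cube_edges => /andP[px xy].
have yx : cube_adj y x by rewrite cube_adj_sym.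
have py := cube_adj_parity xy.
split=> [|_ /mapP[[u v] euv ->] neq].
  rewrite disjoints_subset; apply/subsetP=> w; rewrite !inE => /andP[_ xw].
  apply/negP=> /andP[_ /cube_adj_parity]; rewrite py.
  by rewrite (cube_adj_parity xw) (negPf px).
have := euv; rewrite mem_cube_edges => /andP[pu uv].
have vu : cube_adj v u by rewrite cube_adj_sym.
have [eux|nux] := eqVneq u x.
  subst u; right; exists (nbh y :\ x); first by right.
  have nvy : v != y by apply: contraNneq neq => ->.
  split.
    rewrite -ltnS; apply: leq_trans (card_common_nbh nvy).
    rewrite [X in _ < X](cardsD1 x) !inE vu yx add1n ltnS; apply: subset_leq_card.
    apply/subsetP=> w /setIP[wxv /setD1P[wx wy]]; rewrite !inE wx /=.
    move: wy wxv; rewrite !inE /= => yw /orP[xw|->//]; move/cube_adj_parity: yw.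
    by rewrite (cube_adj_parity xw) py (negPf px).
  apply/subsetP=> w; rewrite !inE /= negb_and negbK => /andP[/orP[/eqP->|/negPf->]].
    by rewrite vu orbT.
  by rewrite orbF => ->.
have [evy|nvy] := eqVneq v y.
  subst v; right; exists (nbh x :\ y); first by left.
  split.
    rewrite -ltnS; apply: leq_trans (card_common_nbh nux).
    rewrite [X in _ < X](cardsD1 y) !inE uv xy add1n ltnS; apply: subset_leq_card.
    apply/subsetP=> w /setIP[wuy /setD1P[wy wx]]; rewrite !inE wy /=.
    move: wx wuy; rewrite !inE /= => xw /orP[->//|yw]; move/cube_adj_parity: yw.
    by rewrite (cube_adj_parity xw) py (negPf px).
  apply/subsetP=> w; rewrite !inE /= negb_and negbK => /andP[/orP[/eqP->|/negPf->]].
    by rewrite uv.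
  by rewrite /= => ->; rewrite orbT.
(* No shared endpoint: each of the two parts of the intersection has at most two vertices, and 2 + 2
   < 5. *)
left; rewrite cube_facetI // ltnS; apply: leq_trans (leq_card_setU _ _) _.
by rewrite -[4]/(2 + 2) leq_add // card_common_nbh.
Qed.

End CubeNeighbourhoods.

(** * A missing face with six vertices *)

(* The six vertices of a 3-dimensional face other than two antipodal ones. *)
Section MissingFace.
Variable m : nat.
Local Notation V := {ffun 'I_m.+3 -> bool}.

Definition face_vertex (b : bool * bool * bool) : V :=
  [ffun i : 'I_m.+3 => match val i with
            | 0 => b.1.1 | 1 => b.1.2 | 2 => b.2 | _ => false end].

Definition belt : {set V} :=
  [set face_vertex b | b in [set b : bool * bool * bool | b \notin
     [:: (false, false, false); (true, true, true)]]].

Definition coord3 (u : V) : bool * bool * bool :=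
  (u ord0, u (lift ord0 ord0), u (lift ord0 (lift ord0 ord0))).

Definition hamming3 (b c : bool * bool * bool) : nat :=
  (b.1.1 != c.1.1) + (b.1.2 != c.1.2) + (b.2 != c.2).

Lemma hamming_ge_coord3 (u v : V) : hamming3 (coord3 u) (coord3 v) <= hamming u v.
Proof. by rewrite /hamming 3!big_ord_recl /hamming3 /= !addnA leq_addr. Qed.

(** The remainder [r] is the distance from [u] to the face; since it does not depend on [b],
    adjacency to the belt becomes a finite check on [coord3 u]. *)
Lemma hamming_face_vertex (u : V) : exists r, forall b,
  hamming u (face_vertex b) = hamming3 (coord3 u) b + r.
Proof.
eexists => b; rewrite /hamming 3!big_ord_recl /hamming3 /= !ffunE /= !addnA.
by congr (_ + _); apply: eq_bigr => i _; rewrite ffunE /=.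
Qed.

Lemma coord3K b : coord3 (face_vertex b) = b.
Proof. by case: b => [[b0 b1] b2]; rewrite /coord3 !ffunE. Qed.

Lemma cube_adj_face_vertex b c :
  cube_adj (face_vertex b) (face_vertex c) = (hamming3 b c == 1).
Proof.
have [r hr] := hamming_face_vertex (face_vertex b).
have r0 : r = 0.
  have := hr b; rewrite coord3K /hamming3 !eqxx /= !add0n => <-.
  by rewrite /hamming big1 // => i _; rewrite eqxx.
by rewrite cube_adjE hr r0 addn0 coord3K.
Qed.

Lemma parity_face_vertex b : parity (face_vertex b) = b.1.1 (+) b.1.2 (+) b.2.
Proof.
rewrite /parity 3!big_ord_recl big1 ?addbF => [|i _]; rewrite !ffunE //=.
by rewrite addbA.
Qed.

Lemma card_belt : #|belt| = 6.
Proof.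
rewrite card_imset; last exact: can_inj coord3K.
rewrite cardsE; set s := [:: _; _]; have := cardC (mem s).
(* The eight triples split as 2 + 6. *)
by rewrite (card_uniqP (isT : uniq s)) !card_prod card_bool => /(@addnI 2 _ 6).
Qed.

(** In a facet containing the belt, [x] is adjacent to its three vertices of weight 1 and [y] to its
    three of weight 2. This forces [coord3 x] to be 000 and [coord3 y] to be 111, at distance 3,
    although [x] and [y] are adjacent. *)
Lemma belt_notin : belt \notin cube_complex m.+3.
Proof.
rewrite inE negb_and negbK; apply/orP; right; apply/hasPn=> _ /mapP[[x y] exy ->].
apply/negP=> /subsetP bel.
have [r hr] := hamming_face_vertex x; have [r' hr'] := hamming_face_vertex y.
have inb b : b \notin [:: (false, false, false); (true, true, true)] ->
    face_vertex b \in cube_facet (x, y).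
  by move=> hb; apply: bel; apply: imset_f; rewrite inE.
have hx b : b \notin [:: (false, false, false); (true, true, true)] ->
    b.1.1 (+) b.1.2 (+) b.2 -> hamming3 (coord3 x) b + r = 1.
  move=> hb pb; move: (inb b hb).
  by rewrite (mem_facet_odd exy) ?parity_face_vertex // inE cube_adjE hr => /eqP.
have hy b : b \notin [:: (false, false, false); (true, true, true)] ->
    ~~ (b.1.1 (+) b.1.2 (+) b.2) -> hamming3 (coord3 y) b + r' = 1.
  move=> hb pb; move: (inb b hb).
  by rewrite (mem_facet_even exy) ?parity_face_vertex // inE cube_adjE hr' => /eqP.
have := hamming_ge_coord3 x y; move: exy; rewrite mem_cube_edges cube_adjE.
case/andP=> _ /eqP->.
move: (hx (true, false, false) isT isT) (hx (false, true, false) isT isT)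
  (hx (false, false, true) isT isT).
move: (hy (false, true, true) isT isT) (hy (true, false, true) isT isT)
  (hy (true, true, false) isT isT).
case: (coord3 x) (coord3 y) => [[[] []] []] [[[] []] []] /=;
  by case: (r) => [|[|?]] //; case: (r') => [|[|?]].
Qed.

(** For [v] of weight 1, the edge from the antipode of [v] in the face to 111 works: the antipode is
    adjacent to the other two vertices of weight 1, and 111 to all those of weight 2. For weight 2,
    use the edge from 000 to the antipode. *)
Lemma belt_facets v : v \in belt -> belt :\ v \in cube_complex m.+3.
Proof.
move=> vb; rewrite inE; apply/andP; split.
  rewrite -card_gt0; have := cardsD1 v belt.
  by rewrite card_belt vb add1n; case: #|_|.
have wit p q : ~~ (p.1.1 (+) p.1.2 (+) p.2) -> hamming3 p q == 1 ->
    (forall b, b \notin [:: (false, false, false); (true, true, true)] ->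
      face_vertex b != v -> (hamming3 p b == 1) || (hamming3 q b == 1)) ->
    has (fun F : {set V} => belt :\ v \subset F)
      [seq cube_facet i | i <- cube_edges m.+3].
  move=> pp pq cov; apply/hasP; exists (cube_facet (face_vertex p, face_vertex q)).
    by apply: map_f; rewrite mem_cube_edges parity_face_vertex pp cube_adj_face_vertex.
  apply/subsetP=> w /setD1P[wv /imsetP[b hb ew]]; rewrite inE in hb.
  by rewrite ew !inE /= !cube_adj_face_vertex; apply: cov; rewrite // -ew.
case/imsetP: vb => b; rewrite inE => hb ev; subst v.
have neq c : (face_vertex c != face_vertex b) = (c != b).
  by rewrite (can_eq coord3K).
case: b hb wit neq => [[b0 b1] b2] hb wit neq.
case: (boolP (b0 (+) b1 (+) b2)) => pb.
  by apply: (wit (~~ b0, ~~ b1, ~~ b2) (true, true, true));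
     case: b0 b1 b2 hb pb neq {wit} => [] [] [] // _ _ neq [[[] []] []] //; rewrite neq.
by apply: (wit (false, false, false) (~~ b0, ~~ b1, ~~ b2));
   case: b0 b1 b2 hb pb neq {wit} => [] [] [] // _ _ neq [[[] []] []] //; rewrite neq.
Qed.

End MissingFace.

(** * Distances in the geometric realization *)

Section RealizationDistance.
Variables (R : realType) (G : connected_graph).
Implicit Types (p q : {ffun G -> R}) (x y v : G) (f : G -> R).
Local Open Scope ring_scope.

Lemma adj_neq x y : adj x y -> x != y.
Proof. by apply: contraTneq => ->; rewrite adj_irr. Qed.

Lemma closed_edgeC x y p : closed_edge x y p -> closed_edge y x p.
Proof.
by case=> px py pxy p0; split=> // [|z zy zx]; [rewrite addrC | apply: p0].
Qed.

Lemma vertex_point_edge x y : adj x y -> closed_edge x y (vertex_point R x).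
Proof.
move=> /adj_neq xy; split; rewrite ?ffunE ?eqxx // ?(eq_sym y) ?(negPf xy) ?addr0 //.
by move=> z zx _; rewrite ffunE (negPf zx).
Qed.

Lemma sum_vertex_point f v : \sum_z vertex_point R v z * f z = f v.
Proof.
rewrite (bigD1 v) //= big1 => [|z /negPf zv]; rewrite ffunE ?zv ?mul0r //.
by rewrite eqxx mul1r addr0.
Qed.

Lemma sum_closed_edge f x y p : adj x y -> closed_edge x y p ->
  \sum_z p z * f z = p x * f x + p y * f y.
Proof.
move=> /adj_neq xy [_ _ _ p0]; rewrite (bigD1 x) // (bigD1 y) ?(eq_sym y) //=.
by rewrite big1 ?addr0 // => z /andP[zx zy]; rewrite p0 ?mul0r.
Qed.

Lemma path_length_ge0 p q l : path_length p q l -> 0 <= l.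
Proof. by elim=> // *; rewrite addr_ge0. Qed.

(* The affine extension of a 1-Lipschitz function on the vertices is 1-Lipschitz
   on the realization. *)
Lemma path_length_ge f p q l :
    (forall x y, adj x y -> `|f x - f y| <= 1) -> path_length p q l ->
  \sum_z q z * f z - \sum_z p z * f z <= l.
Proof.
move=> f1; elim=> {p q l} [p _|p q s x y l xy px qx _ IH]; first by rewrite subrr.
suff : \sum_z q z * f z - \sum_z p z * f z <= `|p x - q x| by lra.
rewrite (sum_closed_edge _ xy px) (sum_closed_edge _ xy qx).
case: px qx => _ _ pE _ [_ _ qE _].
have -> : q x * f x + q y * f y - (p x * f x + p y * f y) =
    (q x - p x) * (f x - f y).
  have -> : p y = 1 - p x by lra.
  have -> : q y = 1 - q x by lra.
  ring.
apply: le_trans (ler_norm _) _; rewrite normrM distrC ler_piMr //.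
exact: f1.
Qed.

Lemma path_length_vertex v x q l :
  connect (@adj G) v x -> path_length (vertex_point R x) q l ->
  exists l', path_length (vertex_point R v) q l'.
Proof.
move=> /connectP[s vs ->]; elim: s v vs l => [|w s IH] v /= => [_|/andP[vw ws]] l ql.
  by exists l.
have [l' hl'] := IH w ws l ql; eexists; apply: (path_length_step vw) hl'.
  exact: vertex_point_edge.
by apply: closed_edgeC; apply: vertex_point_edge; rewrite adj_sym.
Qed.

(** A lower bound on the infimum [path_dist] requires a nonempty set of lengths. *)
Lemma path_length_exists v x y p : adj x y -> closed_edge x y p ->
  exists l, path_length (vertex_point R v) p l.
Proof.
move=> xy pxy; apply: (path_length_vertex (adj_connected v x)).
apply: (path_length_step xy (vertex_point_edge xy) pxy).
by apply: path_length_refl; right; exists x, y.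
Qed.

Lemma path_dist_ge f v x y p :
    (forall x y, adj x y -> `|f x - f y| <= 1) -> adj x y -> closed_edge x y p ->
  p x * f x + p y * f y - f v <= path_dist (vertex_point R v) p.
Proof.
move=> f1 xy pxy; apply: lb_le_inf; first exact: path_length_exists pxy.
move=> l /(path_length_ge f1).
by rewrite (sum_closed_edge _ xy pxy) sum_vertex_point.
Qed.

Lemma path_dist_le p q l : path_length p q l -> path_dist p q <= l.
Proof. by move=> pql; apply: ge_inf => //; exists 0 => k; apply: path_length_ge0. Qed.

Definition midpoint x y : {ffun G -> R} :=
  [ffun z => if (z == x) || (z == y) then 2^-1 else 0].

Lemma midpoint_edge x y : closed_edge x y (midpoint x y).
Proof.
split; rewrite ?ffunE ?eqxx ?orbT /= ?invr_ge0 //; first lra.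
by move=> z zx zy; rewrite ffunE (negPf zx) (negPf zy).
Qed.

Lemma midpointC x y : midpoint x y = midpoint y x.
Proof. by apply/ffunP=> z; rewrite !ffunE orbC. Qed.

Lemma midpoint_ball x y v : adj x y -> adj x v ->
  closed_ball (vertex_point R v) (3 / 2) (midpoint x y).
Proof.
move=> xy xv; have mxy := midpoint_edge x y.
have rm : realization (midpoint x y) by right; exists x, y.
have vx : adj v x by rewrite adj_sym.
split=> //.
(* The path from [v] through [x] to the midpoint has length 1 + 1/2. *)
have := path_length_step vx (vertex_point_edge vx) (closed_edgeC (vertex_point_edge xv))
  (path_length_step xy (vertex_point_edge xy) mxy (path_length_refl rm)).
move/path_dist_le/le_trans; apply.
rewrite !ffunE !eqxx /= (negPf (adj_neq vx)) subr0 normr1 addr0.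
by rewrite ger0_norm; lra.
Qed.

End RealizationDistance.

(** * Identifying the Čech complex of the cube *)

Section CechCube.
Variables (R : realType) (n : nat).
Local Open Scope ring_scope.

Lemma hamming_lipschitz (u x y : hypercube n) : adj x y ->
  `|(hamming u x)%:R - (hamming u y)%:R : R| <= 1.
Proof.
case/(hamming_adj u)=> ->; rewrite -natr1.
  by rewrite opprD addrA subrr add0r normrN1.
by rewrite addrAC subrr add0r normr1.
Qed.

Lemma hammingxx (u : {ffun 'I_n -> bool}) : hamming u u = 0%N.
Proof. by rewrite /hamming big1 // => i _; rewrite eqxx. Qed.

Lemma cech_cube : (0 < n)%N -> cech (hypercube n) (3%:R : R) = cube_complex n.
Proof.
move=> n0; apply/setP=> s; rewrite !inE; congr (_ && _).
apply/asboolP/hasP=> [[p ball]|[_ /mapP[[x y] exy ->] sF]]; last first.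
  have xy : adj (x : hypercube n) y by move: exy; rewrite mem_cube_edges => /andP[].
  exists (midpoint R (x : hypercube n) y) => v /(subsetP sF); rewrite !inE /=.
  case/orP=> [xv|yv]; first exact: (@midpoint_ball R (hypercube n)).
  by rewrite midpointC; apply: (@midpoint_ball R (hypercube n)); rewrite // adj_sym.
(* Nonemptiness of [s] was dropped by [congr]; for empty [s] any edge serves, and [0 < n] provides
   one. *)
have [s0|[v0 v0s]] := set_0Vmem s.
  pose x : hypercube n := [ffun=> false].
  pose y : hypercube n := [ffun i => i == Ordinal n0].
  exists (cube_facet (x, y)); last by rewrite s0 sub0set.
  apply: map_f; rewrite mem_cube_edges; apply/andP; split.
    by rewrite /parity big1 // => i _; rewrite ffunE.
  rewrite /cube_adj (_ : [set _ | _] = [set Ordinal n0]) ?cards1 //.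
  by apply/setP=> i; rewrite !inE !ffunE; case: (i == _).
(* A vertex point [p] is placed on an edge by flipping a coordinate. *)
have [x [y [xy pxy]]] : exists x y : hypercube n, adj x y /\ closed_edge x y p.
  have [[[w ->]|//] _] := ball v0 v0s.
  pose y : hypercube n := [ffun i => w i (+) (i == Ordinal n0)].
  have wy : adj w y.
    rewrite /= /cube_adj (_ : [set _ | _] = [set Ordinal n0]) ?cards1 //.
    by apply/setP=> i; rewrite !inE !ffunE; case: (w i) (i == _) => [] [].
  by exists w, y; split=> //; apply: vertex_point_edge.
wlog px : x y xy pxy / ~~ parity x.
  move=> W; have [px|] := boolP (parity x); last exact: W xy pxy.
  apply: (W y x); rewrite 1?adj_sym //; first exact: closed_edgeC.
  by rewrite (cube_adj_parity xy) px.
exists (cube_facet (x, y)); first by apply: map_f; rewrite mem_cube_edges px.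
apply/subsetP=> v vs; have [_ dvp] := ball v vs.
(* With the distance to [v] as Lipschitz function, its affine extension at [p] is at most 3/2. *)
have := le_trans (@path_dist_ge R (hypercube n) _ v _ _ _ (hamming_lipschitz v) xy pxy) dvp.
rewrite hammingxx subr0 !inE /= !cube_adjE !(hammingC _ v).
case: (pxy) => p0 q0 pq _; have := hamming_adj v xy.
set a := hamming v x; set b := hamming v y.
have [//|a1 /=] := eqVneq a 1%N; have [//|b1 /=] := eqVneq b 1%N.
(* [a] and [b] differ by one and neither is 1, so neither is 0; both being at least 2, their
   weighted mean exceeds 3/2. *)
move=> ab; have [a2 b2] : (2 <= a)%N /\ (2 <= b)%N.
  by case: ab a1 b1 => ->; [case: a => [|[|?]] | case: b => [|[|?]]].
have : (2 : R) <= a%:R by rewrite ler_nat.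
have : (2 : R) <= b%:R by rewrite ler_nat.
by move=> ? ? ?; exfalso; nra.
Qed.

End CechCube.

Theorem theorem5p9 (R : realType) (n : nat) (hn : (4 <= n)%N) :
  is_collapsibility_number (cech (hypercube n) (3%:R : R)) 5.
Proof.
rewrite cech_cube ?(leq_trans _ hn) //.
split; first exact: collapsible_cube_complex.
move=> d; case: n hn => [|[|[|m]]] // _ coll.
(* The goal 5 <= d becomes 6 <= d + 1, with 6 the size of the belt. *)
rewrite -ltnS -(card_belt m).
apply: missing_face_collapsible (@belt_facets m) coll.
- exact: generated_complexP.
- by rewrite -card_gt0 card_belt.
- exact: belt_notin.
Qed.
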